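(* Let $X$ be a non-empty set, $(K,\le)$ a totally ordered set, and $\Phi:X\to\operatorname{seq}(K)$ an injective mapping. Then the $\Phi$-sequential binary relation $\le_\Phi$ on $X$, defined by $x\le_\Phi y \iff \Phi(x)\sqsubseteq\Phi(y)$, is a total order on $X$.
   Context: A total order is a reflexive, transitive, antisymmetric relation in which any two elements are comparable. For a totally preordered set $(K,\le)$ write $u\sim v$ if $u\le v$ and $v\le u$, and $u<v$ if $u\le v$ and not $v\le u$ (if $(K,\le)$ is totally ordered, $\sim$ is equality). Let $\mathbb{N}_0=\{0,1,2,\dots\}$ and let $\operatorname{seq}(K)=K^{\mathbb{N}_0}$ be the set of all sequences $\mathfrak a=\{a_n\}_{n\in\mathbb{N}_0}$ in $K$. Write $\mathfrak a\equiv\mathfrak b$ when $a_n\sim b_n$ for all $n\in\mathbb{N}_0$. Define $\mathfrak a\sqsubseteq\mathfrak b$ when one, and only one, of the following holds: (1) $\mathfrak a\equiv\mathfrak b$; (2) there is $n_0\in\mathbb{N}_0$ such that $a_n\sim b_n$ for all $n<n_0$ and $a_{n_0}<b_{n_0}$ (for $n_0=0$ this just means $a_0<b_0$). *)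

(* Defs.v *)
(* Stdlib, without MathComp. *)
From Stdlib Require Export Relations.Relation_Definitions Vectors.FinFun.

(* [order] is the Stdlib record: reflexive, transitive, antisymmetric. *)
Definition total_order {T : Type} (R : relation T) : Prop :=
  order T R /\ forall x y : T, R x y \/ R y x.

Definition sequence (K : Type) : Type := nat -> K.

(* The following notions are meant for a totally preordered set [(K, le)],
   but their definitions make sense for any relation [le]. *)
Section SequentialRelation.

Context {K : Type} (le : relation K).

Definition sim (u v : K) : Prop := le u v /\ le v u.

Definition slt (u v : K) : Prop := le u v /\ ~ le v u.

Definition seq_equiv (a b : sequence K) : Prop :=
  forall n : nat, sim (a n) (b n).

Definition seq_lt (a b : sequence K) : Prop :=
  exists n0 : nat,
    (forall n : nat, n < n0 -> sim (a n) (b n)) /\ slt (a n0) (b n0).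

(* Exactly one of the two alternatives holds. *)
Definition seq_le (a b : sequence K) : Prop :=
  (seq_equiv a b /\ ~ seq_lt a b) \/ (~ seq_equiv a b /\ seq_lt a b).

Definition sequential_rel {X : Type} (Phi : X -> sequence K) : relation X :=
  fun x y => seq_le (Phi x) (Phi y).

End SequentialRelation.

(* Main.v *)
(* Two sequences that are not termwise equivalent have a least index at which
   they differ, and comparability of the two entries there decides which of them
   is smaller.  Least differing indices also give transitivity: the smaller of
   the indices for (a, b) and (b, c) witnesses a < c. *)
From Stdlib Require Import Classical FunctionalExtensionality Arith Lia.
Require Import Defs.

(** Strong induction on a given witness: either nothing smaller satisfies [P], or the induction
    hypothesis applies to a smaller one. Excluded middle decides which, as [P] need not be
    decidable. *)
Lemma least_nat_witness (P : nat -> Prop) :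
  (exists n, P n) -> exists n, P n /\ forall m, m < n -> ~ P m.
Proof.
intros [n Pn]; induction n as [n IH] using lt_wf_ind.
destruct (classic (exists m, m < n /\ P m)) as [[m [lt_mn Pm]] | no_less].
- exact (IH m lt_mn Pm).
- exists n; split; [exact Pn |].
  intros m lt_mn Pm; apply no_less; now exists m.
Qed.

Lemma seq_equiv_not_lt {K : Type} (le : relation K) (a b : sequence K) :
  seq_equiv le a b -> ~ seq_lt le a b.
Proof. intros eqv [n [_ [_ nle]]]; exact (nle (proj2 (eqv n))). Qed.

(** The alternatives exclude each other for any [le], so the exclusive disjunction collapses to an
    ordinary one, which is easier to split on and to prove. *)
Lemma seq_le_iff {K : Type} (le : relation K) (a b : sequence K) :
  seq_le le a b <-> seq_equiv le a b \/ seq_lt le a b.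
Proof.
unfold seq_le; generalize (seq_equiv_not_lt le a b); tauto.
Qed.

Section Preorder.

Context {K : Type} {le : relation K} (le_pre : preorder K le).

Lemma sim_trans (u v w : K) : sim le u v -> sim le v w -> sim le u w.
Proof.
destruct le_pre as [_ tr]; intros [uv vu] [vw wv].
split; [exact (tr u v w uv vw) | exact (tr w v u wv vu)].
Qed.

Lemma slt_sim_trans (u v w : K) : slt le u v -> sim le v w -> slt le u w.
Proof.
destruct le_pre as [_ tr]; intros [uv nvu] [vw wv].
split; [exact (tr u v w uv vw) |].
intros wu; exact (nvu (tr v w u vw wu)).
Qed.

Lemma sim_slt_trans (u v w : K) : sim le u v -> slt le v w -> slt le u w.
Proof.
destruct le_pre as [_ tr]; intros [uv vu] [vw nwv].
split; [exact (tr u v w uv vw) |].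
intros wu; exact (nwv (tr w u v wu uv)).
Qed.

Lemma slt_trans (u v w : K) : slt le u v -> slt le v w -> slt le u w.
Proof.
destruct le_pre as [_ tr]; intros [uv nvu] [vw _].
split; [exact (tr u v w uv vw) |].
intros wu; exact (nvu (tr v w u vw wu)).
Qed.

Lemma seq_equiv_refl (a : sequence K) : seq_equiv le a a.
Proof. destruct le_pre as [rf _]; intros n; split; apply rf. Qed.

Lemma seq_lt_trans (a b c : sequence K) :
  seq_lt le a b -> seq_lt le b c -> seq_lt le a c.
Proof.
intros [n [ab_n lt_ab]] [m [bc_m lt_bc]]; exists (min n m); split.
- intros k lt_k; apply sim_trans with (b k); [apply ab_n | apply bc_m]; lia.
(* At the smaller index one pair is strict and the other equivalent; if the indices coincide, both
   are strict. *)
- destruct (lt_eq_lt_dec n m) as [[lt_nm | <-] | lt_mn].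
  + rewrite Nat.min_l by lia; exact (slt_sim_trans _ _ _ lt_ab (bc_m n lt_nm)).
  + rewrite Nat.min_id; exact (slt_trans _ _ _ lt_ab lt_bc).
  + rewrite Nat.min_r by lia; exact (sim_slt_trans _ _ _ (ab_n m lt_mn) lt_bc).
Qed.

Lemma seq_le_trans (a b c : sequence K) :
  seq_le le a b -> seq_le le b c -> seq_le le a c.
Proof.
rewrite !seq_le_iff; intros [ab | ab] [bc | bc].
- left; intros n; exact (sim_trans _ _ _ (ab n) (bc n)).
(* With a single strict comparison, its own index also serves for [a] and [c]. *)
- right; destruct bc as [n [bc_n lt_bc]]; exists n; split.
  + intros k lt_k; exact (sim_trans _ _ _ (ab k) (bc_n k lt_k)).
  + exact (sim_slt_trans _ _ _ (ab n) lt_bc).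
- right; destruct ab as [n [ab_n lt_ab]]; exists n; split.
  + intros k lt_k; exact (sim_trans _ _ _ (ab_n k lt_k) (bc k)).
  + exact (slt_sim_trans _ _ _ lt_ab (bc n)).
- right; exact (seq_lt_trans a b c ab bc).
Qed.

Lemma seq_le_antisym (a b : sequence K) :
  seq_le le a b -> seq_le le b a -> seq_equiv le a b.
Proof.
rewrite !seq_le_iff; intros [ab | ab] [ba | ba]; try exact ab.
- intros n; destruct (ba n); now split.
(* Two opposite strict comparisons would compose to [seq_lt le a a], which is absurd. *)
- destruct (seq_equiv_not_lt le a a (seq_equiv_refl a)).
  exact (seq_lt_trans a b a ab ba).
Qed.

End Preorder.

Lemma seq_le_total {K : Type} (le : relation K)
  (le_total : forall u v, le u v \/ le v u) (a b : sequence K) :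
  seq_le le a b \/ seq_le le b a.
Proof.
rewrite !seq_le_iff.
destruct (classic (seq_equiv le a b)) as [ab | nab]; [now left; left |].
apply not_all_ex_not in nab.
destruct (least_nat_witness _ nab) as [n [nsim below]].
assert (sim_below : forall m, m < n -> sim le (a m) (b m)).
(* The minimized predicate is the failure of [sim], so [below] yields a double negation. *)
{ intros m lt_mn; exact (NNPP _ (below m lt_mn)). }
unfold sim in nsim; destruct (le_total (a n) (b n)) as [ab | ba].
- left; right; exists n; split; [exact sim_below | split; tauto].
- right; right; exists n; split; [| split; tauto].
  intros m lt_mn; destruct (sim_below m lt_mn); now split.
Qed.

Theorem corollary3p6
  (X : Type) (K : Type) (le : relation K) (Phi : X -> sequence K)
  (hX : inhabited X)
  (hK : total_order le)
  (hPhi : Injective Phi) :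
  total_order (sequential_rel le Phi).
Proof.
destruct hK as [[rf tr antisym] total].
assert (le_pre : preorder K le) by now split.
unfold sequential_rel; split; [split |].
- intros x; apply seq_le_iff; left; exact (seq_equiv_refl le_pre (Phi x)).
- intros x y z; exact (seq_le_trans le_pre (Phi x) (Phi y) (Phi z)).
(* Injectivity reduces [x = y] to equality of the sequences; termwise equivalence becomes equality
   by antisymmetry of [le]. *)
- intros x y xy yx; apply hPhi, functional_extensionality; intros n.
  destruct (seq_le_antisym le_pre _ _ xy yx n) as [le_n ge_n].
  exact (antisym _ _ le_n ge_n).
- intros x y; exact (seq_le_total le total (Phi x) (Phi y)).
Qed.
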